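(* Let $G$ be a finite group, let $V$ be a faithful irreducible $\mathbb{C}G$-module, and suppose $Z(G)\cong C_d$ is cyclic of order $d\ge 1$. Then the asymptotic growth rate $a(n)$ of $V$ is $$a(n)=\Big(\frac{1}{|G|}\sum_{i=1}^d(\omega^i)^n S_{g^i}\Big)\cdot(\dim V)^n,$$ where $\omega$ is any primitive $d$-th root of unity, $g$ is a generator of $Z(G)$, and $S_{g^i}$ is the sum of the entries of the column of the character table of $G$ corresponding to $g^i$. Thus, if $V,W$ are two faithful irreducible $\mathbb{C}G$-modules, then $c_V(n)=c_W(n)$. Moreover, if $g^i$ and $g^j$ have the same order, then $S_{g^i}=S_{g^j}$.
   Context: Let $\chi_1,\dots,\chi_N$ be the irreducible complex characters of $G$ and $S_h=\sum_{i=1}^N\chi_i(h)$. For a faithful finite-dimensional $\mathbb{C}G$-module $V$, $Z_V(G)\subseteq Z(G)$ is the subgroup of all $h\in G$ acting on $V$ by a scalar $\omega_V(h)$. Define $$c_V(n)=\frac{1}{|G|}\sum_{h\in Z_V(G)}S_h\,\omega_V(h)^n,\qquad a(n)=c_V(n)\cdot(\dim V)^n .$$ This $a(n)$ is the asymptotic growth rate of $V$: if $b(n)$ is the number of irreducible summands of $V^{\otimes n}$ counted with multiplicity, then $b(n)/a(n)\to 1$. *)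

(* Defs.v *)
From mathcomp Require Import all_boot all_order all_algebra all_fingroup.
From mathcomp Require Import all_solvable mxrepresentation.
From mathcomp Require Import classical_sets reals complex.

Set Implicit Arguments.
Unset Strict Implicit.
Unset Printing Implicit Defensive.

Import GRing.Theory Num.Theory.
Local Open Scope ring_scope.
Local Open Scope complex_scope.

(* The complex numbers are R[i] for R : realType, and a finite-dimensional
   CG-module of dimension m is a matrix representation of degree m. *)

(* The socle components of the regular representation index the isomorphism
   classes of irreducible C[G]-modules, and irr_repr i affords the i-th one, so
   that h |-> \tr (irr_repr i h) runs over the irreducible characters of G. *)
Definition char_column_sum (R : realType) (gT : finGroupType) (G : {group gT})
    (h : gT) : R[i] :=
  \sum_(i : DecSocleType (regular_repr R[i] G)) \tr (irr_repr i h).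

(* The default value 0 is only taken off rcenter V. *)
Definition central_scalar (R : realType) (gT : finGroupType) (G : {group gT})
    (m : nat) (V : mx_representation R[i] G m) (h : gT) : R[i] :=
  xget 0 (fun a : R[i] => V h = a%:M).

(* rcenter V is the subgroup of the elements of G acting on V by a scalar. *)
Definition growth_coef (R : realType) (gT : finGroupType) (G : {group gT})
    (m : nat) (V : mx_representation R[i] G m) (n : nat) : R[i] :=
  #|G|%:R^-1 *
  \sum_(h in rcenter V) char_column_sum R G h * central_scalar V h ^+ n.

Definition growth_rate (R : realType) (gT : finGroupType) (G : {group gT})
    (m : nat) (V : mx_representation R[i] G m) (n : nat) : R[i] :=
  growth_coef V n * m%:R ^+ n.

(* Main.v *)
Require Import Defs.
From HB Require Import structures.
From mathcomp Require Import all_boot all_order all_algebra all_fingroup.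
From mathcomp Require Import all_solvable all_field all_character.
From mathcomp Require Import mxrepresentation.
From mathcomp Require Import classical_sets reals complex.

Import GRing.Theory Num.Theory.
Local Open Scope group_scope.
Local Open Scope ring_scope.
Local Open Scope complex_scope.

(** Everything rests on one fact about the column sums [S_h] of the character
table: [S_x = S_y] as soon as [x] and [y] generate the same cyclic subgroup
([char_column_sum_generator]).  The reason is Galois theory.  If [y = x ^+ k]
with [k] prime to the order of [x], some field automorphism raises the roots of
unity of order dividing [#[x]] to the power [k].  It sends [chi x] to
[chi (x ^+ k)] for every character [chi] ([char_aut_exp]) and it permutes the
irreducible characters; hence it sends [S_x] to [S_y], but also to [S_x]
([irr_sum_generator]).

This argument is carried out over the algebraic numbers, where automorphisms
are easily obtained, whereas the modules at hand are over [R[i]].  The passage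
goes through a number field [L]: all irreducible representations over [algC]
can be written with entries in some [L] embedded in [algC], and such an [L] also
embeds in [R[i]], since any simple extension of [rat] embeds in any
algebraically closed field of characteristic 0
([simple_extension_embedding], [number_field_embeddings]).  Absolutely
irreducible representations stay irreducible under both embeddings, and traces
tell them apart, so a count of conjugacy classes shows that all the irreducible
representations over [R[i]] arise in this way.  The column sums over [algC] and
over [R[i]] are then images of the same elements of [L]
([irr_trace_sum_transfer]).

For a faithful irreducible [V], Schur's lemma gives [rcenter V = 'Z(G)]
([rcenter_faithful_irr]), and the scalar by which a generator [g] of the centre
acts is a primitive root of unity [a] of order [d] ([central_scalar_primitive]).
The formula for [growth_coef V] with [w = a] is then its definition.  Another
primitive root is [w = a ^+ k], the scalar by which [g ^+ k] acts, and
[g ^+ k] is also a generator; rewriting the sum in terms of [g ^+ k] replaces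
[S_(g ^+ i)] by [S_(g ^+ (k * i))], which has the same value ([growth_coefE]).
As the right-hand side does not mention [V], neither does [growth_coef].
Finally, two elements of the same order in a cyclic group generate the same
subgroup, which gives the last claim. *)

(** * Embeddings of number fields *)

(** The embedding sends [z] to a root [t] in [K] of the minimal polynomial of
[z].  Every element of [L] is the value at [z] of a polynomial [q] over [F],
and its image, the value of [q] at [t], does not depend on the choice of [q]
because the minimal polynomial divides any polynomial vanishing at [z]. *)
Lemma simple_extension_embedding (F : fieldType) (L : fieldExtType F)
    (K : closedFieldType) (f : {rmorphism F -> K}) (z : L) :
  <<1; z>>%VS = fullv -> inhabited {rmorphism L -> K}.
Proof.
move=> genL.
have /polyOver1P[p Dp] := minPolyOver 1%AS z.
have [t pt0] : exists t, root (map_poly f p) t.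
  apply: closed_rootP; rewrite size_map_poly -(size_map_poly (in_alg L)) -Dp.
  by rewrite size_minPoly.
have reprL x : exists q : {poly F}, x == (map_poly (in_alg L) q).[z].
  have: x \in <<1; z>>%VS by rewrite genL memvf.
  by case/Fadjoin_polyP=> _ /polyOver1P[q ->] ->; exists q.
pose q_ x := xchoose (reprL x).
have q_K x : (map_poly (in_alg L) (q_ x)).[z] = x.
  by rewrite [RHS](eqP (xchooseP (reprL x))).
pose phi x := (map_poly f (q_ x)).[t].
have phiE q : phi (map_poly (in_alg L) q).[z] = (map_poly f q).[t].
  apply/eqP; rewrite -subr_eq0 /phi -hornerN -hornerD -!rmorphN -rmorphD /=.
  apply: root_dvdp pt0; rewrite dvdp_map -(dvdp_map (in_alg L)) -Dp.
  apply: minPoly_dvdp.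
    by apply/polyOver1P; exists (q_ (map_poly (in_alg L) q).[z] - q).
  by rewrite /root rmorphB hornerD hornerN q_K subrr.
have phiB : zmod_morphism phi.
  move=> x y; rewrite -{1}(q_K x) -{1}(q_K y) -hornerN -hornerD -rmorphB phiE.
  by rewrite rmorphB hornerD hornerN.
have phiM : monoid_morphism phi.
  split=> [|x y]; first by have := phiE 1; rewrite !rmorph1 !hornerC.
  by rewrite -{1}(q_K x) -{1}(q_K y) -hornerM -rmorphM phiE rmorphM hornerM.
pose phiZ := GRing.isZmodMorphism.Build _ _ phi phiB.
pose phi1 := GRing.isMonoidMorphism.Build _ _ phi phiM.
exact: (inhabits (HB.pack phi phiZ phi1 : {rmorphism L -> K})).
Qed.

(** The field [L] is generated over [rat] by a primitive element of the
algebraic numbers in [s]. *)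
Lemma number_field_embeddings (K : closedFieldType) (f : {rmorphism rat -> K})
    (s : seq algC) :
  exists (L : fieldExtType rat) (sigma : {rmorphism L -> algC})
         (tau : {rmorphism L -> K}),
    forall a, a \in s -> exists b, sigma b = a.
Proof.
have [z _ [ps Ds]] := algC_PET s.
have [L [sigma [[|zL [|? ?]] //= [zLK] genL]]] := num_field_exists [:: z].
rewrite span_seq1 in genL.
have [tau] := simple_extension_embedding _ _ _ f zL genL.
exists L, sigma, tau => a; rewrite Ds => /mapP[p _ ->].
exists (map_poly (in_alg L) p).[zL].
rewrite -horner_map zLK -map_poly_comp; congr _.[z].
by apply: eq_map_poly => b /=; rewrite alg_num_field fmorph_rat.
Qed.

(** * Transfer of the character table between algebraically closed fields *)

Lemma repr_descent (L F : fieldType) (sigma : {rmorphism L -> F})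
    (gT : finGroupType) (G : {group gT}) (n : nat)
    (rG : mx_representation F G n) :
    (forall x, x \in G -> forall i j, exists b, sigma b = rG x i j) ->
  exists rL : mx_representation L G n,
    forall x, x \in G -> map_mx sigma (rL x) = rG x.
Proof.
move=> im_rG.
have ex_r x : exists A : 'M[L]_n, x \in G -> map_mx sigma A = rG x.
  have [Gx | ] := boolP (x \in G); last by exists 0.
  have /fin_all_exists[a Da] i := fin_all_exists (im_rG x Gx i).
  by exists (\matrix_(i, j) a i j) => _; apply/matrixP=> i j; rewrite !mxE.
have [r Dr] := fin_all_exists ex_r.
suffices repr_r : mx_repr G r by exists (MxRepresentation repr_r).
split=> [|x y Gx Gy]; apply: (map_mx_inj (f := sigma)).
  by rewrite Dr ?group1 // repr_mx1 map_mx1.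
by rewrite map_mxM !Dr ?groupM // repr_mxM.
Qed.

(** Both column sums are images of the sum [s h] of the traces of the
irreducible [algC]-representations once these are written over [L].  Over [K],
the point is that their images under [tau] form a complete set of irreducible
representations: they are pairwise non-isomorphic since their traces differ
already in [L], and over either field the number of classes of irreducible
representations is the number of conjugacy classes of [G]. *)
Lemma irr_trace_sum_transfer (K : closedFieldType) (f : {rmorphism rat -> K})
    (gT : finGroupType) (G : {group gT}) :
  exists (L : fieldExtType rat) (sigma : {rmorphism L -> algC})
         (tau : {rmorphism L -> K}) (s : gT -> L),
    forall h, h \in G ->
      sigma (s h) = \sum_(i : Iirr G) 'chi_i h /\
      tau (s h) =
        \sum_(i : DecSocleType (regular_repr K G)) \tr (irr_repr i h).
Proof.
set sK := DecSocleType _.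
have K'G : [pchar K]^'.-group G.
  by apply/pgroupP=> p _ _; rewrite inE /= (fmorph_pchar f) pchar_num.
pose n_ (i : Iirr G) := irr_degree (socle_of_Iirr i).
pose entry (u : {i : Iirr G & 'I_(n_ i) * 'I_(n_ i)}%type * gT) : algC :=
  'Chi_(tag u.1) u.2 (tagged u.1).1 (tagged u.1).2.
have [L [sigma [tau im]]] := number_field_embeddings K f (codom entry).
have ex_r (i : Iirr G) : exists rL : mx_representation L G (n_ i),
    forall x, x \in G -> map_mx sigma (rL x) = 'Chi_i x.
  apply: repr_descent => x _ j k; apply: im.
  exact: (codom_f entry (Tagged _ (j, k), x)).
have [r Dr] := fin_all_exists ex_r.
have chi_r i h : h \in G -> sigma (\tr (r i h)) = 'chi_i h.
  by move=> Gh; rewrite -trace_map_mx Dr // -irrRepr cfunE Gh.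
have irr_r i : mx_irreducible (map_repr tau (r i)).
  (* Absolute irreducibility, unlike irreducibility, goes down along sigma
     and up along tau. *)
  apply: mx_abs_irrW; rewrite map_mx_abs_irr -(map_mx_abs_irr sigma).
  have /mx_rsim_abs_irr -> : mx_rsim (map_repr sigma (r i)) 'Chi_i.
    exists 1%:M; rewrite ?row_free_unit ?unitmx1 // => x Gx.
    by rewrite mulmx1 mul1mx; apply: Dr.
  exact/groupC/socle_irr.
pose c i := irr_comp sK (map_repr tau (r i)).
have tr_c i h : h \in G -> tau (\tr (r i h)) = \tr (irr_repr (c i) h).
  move=> Gh; rewrite -trace_map_mx.
  exact: (mxtrace_rsim (rsim_irr_comp_pchar sK K'G (irr_r i)) Gh).
have inj_c : injective c.
  move=> i j eq_c; apply/irr_inj/cfun_inP => h Gh.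
  rewrite -!chi_r //; congr (sigma _); apply: (fmorph_inj tau).
  by rewrite !tr_c // eq_c.
have bij_c : bijective c.
  apply: inj_card_bij inj_c _.
  rewrite card_ord NirrE card_irr_pchar //.
  exact: group_closure_closed_field.
exists L, sigma, tau, (fun h => \sum_i \tr (r i h)) => h Gh.
rewrite !rmorph_sum; split; first by apply: eq_bigr => i _; apply: chi_r.
rewrite [RHS](reindex c) /=; last exact: onW_bij.
by apply: eq_bigr => i _; apply: tr_c.
Qed.

(** * Galois invariance of the column sums *)

(** The restriction of [chi] to [<[h]>] is a sum of linear characters, whose
values at [h] are roots of unity of order dividing [#[h]]. *)
Lemma char_aut_exp (u : {rmorphism algC -> algC}) (k : nat)
    (gT : finGroupType) (G : {group gT}) (chi : 'CF(G)) (h : gT) :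
    (forall z, z ^+ #[h]%g = 1 -> u z = z ^+ k) ->
  chi \is a character -> h \in G -> u (chi h) = chi (h ^+ k)%g.
Proof.
move=> uk Nchi Gh; have sHG : <[h]>%g \subset G by rewrite cycle_subG.
rewrite -!(cfResE chi sHG) ?mem_cycle ?cycle_id //.
have [r ->] := char_sum_irr (cfRes_char <[h]>%G Nchi).
rewrite !sum_cfunE rmorph_sum; apply: eq_bigr => i _.
have lin_i := irr_cyclic_lin i (cycle_cyclic h).
by rewrite lin_charX ?cycle_id // uk // lin_char_unity_root ?cycle_id.
Qed.

(** With [y = x ^+ k] and [u] an automorphism raising the relevant roots of
unity to the power [k], ['chi_i y] is the value at [x] of the conjugate of
['chi_i] by [u], and conjugation by [u] permutes the irreducible characters. *)
Lemma irr_sum_generator (gT : finGroupType) (G : {group gT}) (x y : gT) :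
    x \in G -> <[x]>%g = <[y]>%g ->
  \sum_(i : Iirr G) 'chi_i x = \sum_(i : Iirr G) 'chi_i y.
Proof.
move=> Gx eq_xy.
have /cycleP[k Dy] : y \in <[x]>%g by rewrite eq_xy cycle_id.
have co_k : coprime k #[x]%g.
  by rewrite coprime_sym -generator_coprime -Dy /generator eq_xy.
have [u uk] := Qn_aut_exists co_k.
rewrite (reindex_inj (aut_Iirr_inj u)) /=; apply: eq_bigr => i _.
by rewrite aut_IirrE cfunE Dy; apply: char_aut_exp uk (irr_char i) Gx.
Qed.

(** Both embeddings of the number field being injective, the equality of column
sums over [algC] pulls back to that field and pushes forward to [R[i]]. *)
Lemma char_column_sum_generator (R : realType) (gT : finGroupType)
    (G : {group gT}) (x y : gT) :
    x \in G -> <[x]>%g = <[y]>%g ->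
  char_column_sum R G x = char_column_sum R G y.
Proof.
move=> Gx eq_xy.
have Gy : y \in G by rewrite -cycle_subG -eq_xy cycle_subG.
have [L [sigma [tau [s Ds]]]] := irr_trace_sum_transfer R[i] ratr gT G.
have [sx tx] := Ds x Gx; have [sy ty] := Ds y Gy.
rewrite /char_column_sum -tx -ty; congr (tau _); apply: (fmorph_inj sigma).
by rewrite sx sy; apply: irr_sum_generator.
Qed.

(** * The action of the centre on a faithful irreducible module *)

Lemma sum_cycle (T : nmodType) (gT : finGroupType) (g : gT) (F : gT -> T) :
  \sum_(h in <[g]>%g) F h = \sum_(1 <= i < #[g]%g.+1) F (g ^+ i)%g.
Proof.
rewrite big_add1 big_mkord /=.
have inj_exp : injective (fun i : 'I_#[g]%g => (g ^+ i.+1)%g).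
  move=> i j /eqP; rewrite eq_expg_mod_order -addn1 -[j.+1]addn1 eqn_modDr.
  by rewrite !modn_small // => /eqP/val_inj.
rewrite -(big_imset _ (in2W inj_exp)); apply: eq_bigl => h; symmetry.
suffices /eqP -> : [set (g ^+ i.+1)%g | i : 'I_#[g]%g] == <[g]>%g by [].
rewrite eqEcard card_imset // card_ord leqnn andbT.
by apply/fintype.subsetP=> _ /imsetP[i _ ->]; apply: mem_cycle.
Qed.

Section CentralScalar.

Variables (R : realType) (gT : finGroupType) (G : {group gT}) (m : nat).
Variable V : mx_representation R[i] G m.
Hypotheses (V_faithful : mx_faithful V) (V_irr : mx_irreducible V).

(** An element acting by a scalar commutes with everything in the image of [V],
hence is central as [V] is faithful; the converse is Schur's lemma. *)
Lemma rcenter_faithful_irr : rcenter V = 'Z(G)%g.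
Proof.
apply/setP=> h; apply/idP/idP => [|Zh].
  case/setIdP=> Gh /is_scalar_mxP[a Va]; apply/centerP; split=> // y Gy.
  apply: (mx_faithful_inj V_faithful); rewrite ?groupM //.
  by rewrite !repr_mxM // Va scalar_mxC.
have [Gh cGh] := centerP _ _ Zh; apply/setIdP; split=> //.
have absV := group_closure_closed_field V_irr.
apply: (mx_abs_irr_cent_scalar absV).
by apply/centgmxP=> y Gy; rewrite -!repr_mxM // cGh.
Qed.

Lemma central_scalarE h : h \in 'Z(G)%g -> V h = (central_scalar V h)%:M.
Proof.
rewrite -rcenter_faithful_irr => /setIdP[_ /is_scalar_mxP exa].
exact: (xgetPex 0 exa).
Qed.

Lemma central_scalar_unique h a :
  h \in 'Z(G)%g -> V h = a%:M -> central_scalar V h = a.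
Proof.
move=> Zh Va; have /mx_irrP[m_gt0 _] := V_irr.
have /matrixP/(_ (Ordinal m_gt0) (Ordinal m_gt0)) :
  (central_scalar V h)%:M = a%:M :> 'M_m by rewrite -central_scalarE.
by rewrite !mxE eqxx.
Qed.

Lemma central_scalarX h k :
  h \in 'Z(G)%g -> central_scalar V (h ^+ k)%g = central_scalar V h ^+ k.
Proof.
move=> Zh; apply: central_scalar_unique; first exact: groupX.
have Gh : h \in G by have [] := centerP _ _ Zh.
elim: k => [|k IHk]; first by rewrite repr_mx1.
by rewrite expgS repr_mxM ?groupX // IHk (central_scalarE h Zh) exprS scalar_mxM.
Qed.

(** Since [V] is faithful, a power of [g] acting trivially is trivial. *)
Lemma central_scalar_primitive g :
  g \in 'Z(G)%g -> #[g]%g.-primitive_root (central_scalar V g).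
Proof.
move=> Zg; have Gg : g \in G by have [] := centerP _ _ Zg.
have scalar_eq1 k : central_scalar V g ^+ k = 1 -> (g ^+ k = 1)%g.
  rewrite -central_scalarX // => ak1.
  apply: (mx_faithful_inj V_faithful); rewrite ?groupX //.
  by rewrite repr_mx1 central_scalarE ?groupX // ak1.
have ad1 : central_scalar V g ^+ #[g]%g = 1.
  rewrite -central_scalarX // expg_order.
  by apply: central_scalar_unique => //; rewrite repr_mx1.
have [k prim_k k_dv] := prim_order_exists (order_gt0 g) ad1.
suffices /eqP <- : k == #[g]%g by [].
by rewrite eqn_dvd k_dv order_dvdn; apply/eqP/scalar_eq1/prim_expr_order.
Qed.

(** The root [w] need not be the scalar by which [g] acts, but it is the scalar
by which some other generator [g ^+ k] of the centre acts.  Listing the centre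
as powers of [g ^+ k] turns the definition of [growth_coef] into the required
sum, up to replacing [g ^+ i] by its power [g ^+ (k * i)]; as [k] is prime to
the order of [g], this does not change the column sum. *)
Lemma growth_coefE (w : R[i]) (g : gT) (n : nat) :
    #|'Z(G)%g|.-primitive_root w -> generator 'Z(G)%g g ->
  growth_coef V n =
  #|G|%:R^-1 * \sum_(1 <= i < #|'Z(G)%g|.+1)
                 (w ^+ i) ^+ n * char_column_sum R G (g ^+ i)%g.
Proof.
move=> prim_w /eqP gen_g.
have ord_g : #[g]%g = #|'Z(G)%g| by rewrite gen_g.
have Zg : g \in 'Z(G)%g by rewrite gen_g cycle_id.
have prim_a := central_scalar_primitive g Zg; rewrite ord_g in prim_a.
have [[k /= _] Dw] := prim_rootP prim_a (prim_expr_order prim_w).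
have co_k : coprime #[g]%g k.
  by rewrite coprime_sym ord_g -(prim_root_exp_coprime k prim_a) -Dw.
have gen_gk : 'Z(G)%g = <[g ^+ k]>%g.
  rewrite gen_g; apply/eqP.
  by rewrite -[_ == _]/(generator _ _) generator_coprime.
rewrite /growth_coef rcenter_faithful_irr gen_gk -orderE sum_cycle.
congr (_ * _); apply: eq_bigr => j _.
have -> : central_scalar V ((g ^+ k) ^+ j)%g = w ^+ j.
  by rewrite !central_scalarX ?groupX // -Dw.
suffices -> : char_column_sum R G ((g ^+ k) ^+ j)%g
              = char_column_sum R G (g ^+ j)%g by exact: mulrC.
have Gg : g \in G by have [] := centerP _ _ Zg.
apply: char_column_sum_generator; first by rewrite !groupX.
rewrite -expgM mulnC expgM; apply/esym/eqP.
rewrite -[_ == _]/(generator _ _) generator_coprime.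
exact: coprime_dvdl (orderXdvd _ _) co_k.
Qed.

End CentralScalar.

Arguments central_scalar_primitive {R gT G m V}.
Arguments growth_coefE {R gT G m V}.

(** * The growth rate *)

Theorem theorem5 (R : realType) (gT : finGroupType) (G : {group gT})
    (m : nat) (V : mx_representation R[i] G m)
    (V_faithful : mx_faithful V) (V_irr : mx_irreducible V)
    (d : nat) (d_ge1 : (1 <= d)%N)
    (Z_cyclic : cyclic 'Z(G)) (card_Z : #|'Z(G)| = d) :
  [/\ forall (w : R[i]) (g : gT), d.-primitive_root w -> generator 'Z(G) g ->
        forall n : nat,
          growth_rate V n =
          (#|G|%:R^-1 *
             \sum_(1 <= i < d.+1) (w ^+ i) ^+ n * char_column_sum R G (g ^+ i)%g)
          * m%:R ^+ n,
      forall (m' : nat) (W : mx_representation R[i] G m'),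
        mx_faithful W -> mx_irreducible W ->
        forall n : nat, growth_coef V n = growth_coef W n
    & forall g : gT, generator 'Z(G) g ->
        forall i j : nat, #[g ^+ i]%g = #[g ^+ j]%g ->
          char_column_sum R G (g ^+ i)%g = char_column_sum R G (g ^+ j)%g].
Proof.
split.
- move=> w g prim_w gen_g n; rewrite -card_Z in prim_w *.
  by rewrite /growth_rate (growth_coefE V_faithful V_irr w g).
- move=> m' W W_faithful W_irr n.
  have [g Dg] := cyclicP Z_cyclic.
  have Zg : g \in 'Z(G)%g by rewrite Dg cycle_id.
  have gen_g : generator 'Z(G) g by apply/eqP.
  have prim_a := central_scalar_primitive V_faithful V_irr g Zg.
  rewrite orderE -Dg in prim_a.
  rewrite (growth_coefE V_faithful V_irr _ g n prim_a gen_g).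
  by rewrite (growth_coefE W_faithful W_irr _ g n prim_a gen_g).
move=> g /eqP gen_g k l ord_eq; apply: char_column_sum_generator.
  have : g \in 'Z(G)%g by rewrite gen_g cycle_id.
  by case/centerP=> Gg _; apply: groupX.
apply/eqP; rewrite (eq_subG_cyclic (cycle_cyclic g)) ?cycle_subG ?mem_cycle //.
by apply/eqP.
Qed.
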